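(* Let $G$ be the incidence graph of a nontrivial symmetric $2$-$(v,k,\lambda)$ design, and let $\Gamma$ be a finite abelian group with invariant factors $d_1\mid\cdots\mid d_r$. (a) If $G$ admits an affinely generating $\Gamma$-magic map, then $d_r=\exp(\Gamma)\mid k(k-\lambda)$. (b) If $r\ge2$ and $G$ admits a generating $\Gamma$-magic map, then $d_{r-1}\mid k(k-\lambda)$. In particular, if $|\Gamma|=2v$ and $G$ admits a $\Gamma$-distance magic labeling, then $$\Gamma\hookrightarrow\mathsf S_{\mathrm{red}}(G)\qquad\text{and}\qquad 2v\mid k(k-\lambda)^{v-1}.$$
   Context: A symmetric $2$-$(v,k,\lambda)$ design has $v$ points and $v$ blocks, every block contains $k$ points, every point lies in $k$ blocks, and every pair of distinct points lies in exactly $\lambda$ blocks; nontrivial means $1<k<v-1$. Its incidence graph is the bipartite graph on the disjoint union of the point set and the block set, with a point adjacent to a block exactly when they are incident (a $k$-regular graph of order $2v$). The invariant factors of a finite abelian group $\Gamma$ are the integers $d_1\mid\cdots\mid d_r$, all $>1$ (with $r=1$, $d_1=1$ for the trivial group), such that $\Gamma\cong\mathbb Z/d_1\mathbb Z\oplus\cdots\oplus\mathbb Z/d_r\mathbb Z$; $\exp$ denotes the exponent. $H\hookrightarrow K$ means that there exists an injective group homomorphism $H\to K$. A map $f\colon V(G)\to\Gamma$ is a $\Gamma$-magic map if there is $\gamma\in\Gamma$ with $\sum_{u\in N_G(x)}f(u)=\gamma$ for every $x\in V(G)$, where $N_G(x)$ is the open neighborhood. It is generating if its labels generate $\Gamma$,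 and affinely generating if $\langle f(x)-f(y)\mid x,y\in V(G)\rangle=\Gamma$. A $\Gamma$-distance magic labeling is a bijective $\Gamma$-magic map. For a regular graph $G$ with adjacency matrix $A$, let $\Lambda_{\mathbf 1}=\mathbb Z^{V(G)}/\mathbb Z\mathbf 1$ with $\mathbf 1$ the all-one vector, let $\overline A\colon\Lambda_{\mathbf 1}\to\Lambda_{\mathbf 1}$ be $\overline A([x])=[Ax]$, and let $\mathsf S_{\mathrm{red}}(G)=\Lambda_{\mathbf 1}/\overline A(\Lambda_{\mathbf 1})$ be its cokernel. *)

(* Defs.v *)
From HB Require Import structures.
From mathcomp Require Import all_boot all_fingroup all_algebra all_solvable.
From mathcomp Require Import boolp.

Set Implicit Arguments.
Unset Strict Implicit.
Unset Printing Implicit Defensive.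

Import GRing.Theory.
Local Open Scope ring_scope.
Local Open Scope quotient_scope.

Record symdesign (v k l : nat) := SymDesign {
  point : finType;
  block : finType;
  inc : point -> block -> bool;
  card_point : #|point| = v;
  card_block : #|block| = v;
  block_size : forall b, #|[set p | inc p b]| = k;
  point_degree : forall p, #|[set b | inc p b]| = k;
  pair_degree : forall p q, p != q -> #|[set b | inc p b && inc q b]| = l
}.

Definition nontrivial_params (v k : nat) : bool := (1 < k < v - 1)%N.

Record sgraph := SGraph {
  vertex :> finType;
  adj : rel vertex;
  adj_sym : symmetric adj;
  adj_irrefl : irreflexive adj
}.

Definition nbh (G : sgraph) (x : G) : {set G} := [set y | adj x y].

Record rgraph := RGraph {
  rgraph_sgraph :> sgraph;
  degree : nat;
  rgraph_regular : forall x : rgraph_sgraph, #|nbh x| = degree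
}.

Section IncidenceGraph.
Variables (v k l : nat) (D : symdesign v k l).

Definition inc_adj (x y : point D + block D) : bool :=
  match x, y with
  | inl p, inr b => inc p b
  | inr b, inl p => inc p b
  | _, _ => false
  end.

Lemma inc_adj_sym : symmetric inc_adj.
Proof. by case=> [p|b] [q|c]. Qed.

Lemma inc_adj_irrefl : irreflexive inc_adj.
Proof. by case. Qed.

Definition incidence_sgraph : sgraph := SGraph inc_adj_sym inc_adj_irrefl.

Lemma incidence_regular (x : incidence_sgraph) : #|nbh x| = k.
Proof.
case: x => [p|b].
- apply: etrans (point_degree p); rewrite -(card_imset _ (@inr_inj (point D) (block D))).
  apply: eq_card=> -[q|c]; rewrite !inE /=.
  + by symmetry; apply/imsetP=> -[].
  + by rewrite (mem_imset _ _ (@inr_inj _ _)) inE.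
- apply: etrans (block_size b); rewrite -(card_imset _ (@inl_inj (point D) (block D))).
  apply: eq_card=> -[q|c]; rewrite !inE /=.
  + by rewrite (mem_imset _ _ (@inl_inj _ _)) inE.
  + by symmetry; apply/imsetP=> -[].
Qed.

Definition incidence_graph : rgraph := RGraph incidence_regular.

End IncidenceGraph.

(* For d > 0 the group 'I_d.-1.+1 is Z/dZ, including d = 1 (unlike 'Z_d). *)
Definition cyclic_sum (d : seq nat) : finGroupType :=
  {dffun forall i : 'I_(size d), 'I_(nth 0%N d i).-1.+1}.

Definition invariant_factors (A : finZmodType) (d : seq nat) : Prop :=
  [/\ (d != [::]) && all (ltn 1) d \/ #|A| = 1%N /\ d = [:: 1%N],
      sorted dvdn d
    & [set: A] \isog [set: cyclic_sum d]].

Section Magic.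
Variables (G : sgraph) (A : finZmodType).
Implicit Type f : G -> A.

Definition magic_map f : Prop :=
  exists c : A, forall x : G, \sum_(u in nbh x) f u = c.

Definition generating f : Prop :=
  <<[set f x | x : G]>>%g = [set: A].

Definition affinely_generating f : Prop :=
  <<[set f x - f y | x : G, y : G]>>%g = [set: A].

Definition distance_magic_labeling f : Prop := bijective f /\ magic_map f.

End Magic.

Section Cokernel.
Variables (U V : zmodType) (f : {additive U -> V}).

Definition im_pred : {pred V} := fun y => `[< exists x, y = f x >].

Lemma im_pred_zmod_closed : zmod_closed im_pred.
Proof.
split; first by apply/asboolP; exists 0; rewrite raddf0.
move=> _ _ /asboolP[x ->] /asboolP[y ->].
by apply/asboolP; exists (x - y); rewrite raddfB.
Qed.

HB.instance Definition _ :=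
  GRing.isZmodClosed.Build V im_pred im_pred_zmod_closed.

Definition coker : zmodType := {ideal_quot im_pred}.

End Cokernel.

Section OnesSubgroup.
Variable V : finType.

Definition ones_pred : {pred {ffun V -> int}} :=
  fun x => `[< exists z : int, x = [ffun=> 1] *~ z >].

Lemma ones_pred_zmod_closed : zmod_closed ones_pred.
Proof.
split; first by apply/asboolP; exists 0; rewrite mulr0z.
move=> _ _ /asboolP[x ->] /asboolP[y ->].
by apply/asboolP; exists (x - y); rewrite mulrzBr.
Qed.

HB.instance Definition _ :=
  GRing.isZmodClosed.Build {ffun V -> int} ones_pred ones_pred_zmod_closed.

End OnesSubgroup.

Notation Lambda1 V := {ideal_quot (@ones_pred V)}.

Section ReducedGroup.
Variable G : rgraph.

Definition adj_entry (x y : G) : int := (adj x y)%:R.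

Definition adj_op (x : {ffun G -> int}) : {ffun G -> int} :=
  [ffun u => \sum_w adj_entry u w * x w].

Lemma adj_op_zmod_morphism : zmod_morphism adj_op.
Proof.
move=> x y; apply/ffunP=> u; rewrite !ffunE -sumrB.
by apply: eq_bigr => w _; rewrite !ffunE mulrBr.
Qed.

HB.instance Definition _ :=
  GRing.isZmodMorphism.Build {ffun G -> int} {ffun G -> int} adj_op
    adj_op_zmod_morphism.

Lemma adj_op_ones : adj_op [ffun=> 1] = [ffun=> 1] *~ (degree G)%:Z.
Proof.
apply/ffunP=> u; rewrite !ffunE -pmulrn ffunMnE !ffunE.
rewrite -(rgraph_regular u) -sum1_card natr_sum [RHS]big_mkcond /=.
by apply: eq_bigr => w _; rewrite ffunE mulr1 /adj_entry inE; case: (adj u w).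
Qed.

Definition Abar_fun (q : Lambda1 G) : Lambda1 G :=
  \pi_(Lambda1 G) (adj_op (generic_quotient.repr q)).

Lemma Abar_funE (x : {ffun G -> int}) :
  Abar_fun (\pi_(Lambda1 G) x) = \pi_(Lambda1 G) (adj_op x).
Proof.
apply/eqP; rewrite /Abar_fun -Quotient.idealrBE -raddfB /=.
have: generic_quotient.repr (\pi_(Lambda1 G) x) - x \in @ones_pred G.
  by rewrite Quotient.idealrBE reprK.
case/asboolP=> z ->; apply/asboolP; exists ((degree G)%:Z * z).
by rewrite raddfMz /= adj_op_ones mulrzA.
Qed.

Lemma Abar_zmod_morphism : zmod_morphism Abar_fun.
Proof.
move=> p q; rewrite -[p]reprK -[q]reprK -raddfB /= !Abar_funE.
by rewrite raddfB /= raddfB.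
Qed.

HB.instance Definition _ :=
  GRing.isZmodMorphism.Build (Lambda1 G) (Lambda1 G) Abar_fun Abar_zmod_morphism.

Definition Abar : {additive Lambda1 G -> Lambda1 G} := Abar_fun.

Definition S_red : zmodType := coker Abar.

End ReducedGroup.

Definition embeds (A B : zmodType) : Prop :=
  exists h : {additive A -> B}, injective h.

(* Main.v *)
(* Let [N] be the incidence matrix, so [N N^T = N^T N = (k - l) I + l J]. Counting
   twice the labels of points on the blocks through a point [p] shows that
   [k (k - l) f(x)] does not depend on [x] for a magic map [f]; as this holds over
   every abelian group, differences of labels are killed by [k (k - l)], which
   gives (a), and [k (k - l) A] is cyclic if the labels generate [A], which gives (b).

   For a distance magic labeling, the invariant factors give a perfect pairing
   [A x A -> Z/e], and [S_red] is dual to the cokernel of the adjacency matrix on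
   the vectors of sum zero, a cokernel that surjects onto [A]; dividing by [e] turns
   [<a, f(-)>] into a class of [S_red], which embeds [A]. The divisibility of
   [k (k - l)^(v-1)] holds because [A] is a quotient of the cokernel of a rank one
   modification of the adjacency matrix whose determinant is [+- k (k - l)^(v-1)]. *)

Require Import Defs.
From HB Require Import structures.
From mathcomp Require Import all_boot all_fingroup all_algebra all_solvable.
From mathcomp Require Import all_order boolp ring zify.

Set Implicit Arguments.
Unset Strict Implicit.
Unset Printing Implicit Defensive.

(** * Symmetric designs and their incidence matrices *)

Section RankOne.
Import GRing.Theory.
Local Open Scope ring_scope.

(* Both sides are [\det (block_mx 1 w (- u) c%:M) * c]. *)
Lemma det_scalar_add_rank1 (R : comNzRingType) n (c : R) (u : 'cV[R]_n) (w : 'rV[R]_n) :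
  \det (c%:M + u *m w) * c = (c + (w *m u) 0 0) * c ^+ n.
Proof.
pose B : 'M_(1 + n) := block_mx 1%:M w (- u) c%:M.
have dB : \det B = \det (c%:M + u *m w).
  have -> : \det B = \det (block_mx 1%:M 0 u 1%:M *m B).
    by rewrite det_mulmx det_lblock !det1 !mul1r.
  rewrite mulmx_block !mul1mx !mul0mx !addr0 mulmx1 subrr.
  by rewrite det_ublock det1 mul1r addrC.
have <- : \det (B *m block_mx c%:M 0 u 1%:M) = (c + (w *m u) 0 0) * c ^+ n.
  rewrite mulmx_block !mul1mx !mulmx1 !mulmx0 !add0r mulNmx.
  rewrite mul_mx_scalar mul_scalar_mx addNr det_ublock det_scalar.
  by rewrite det_mx11 !mxE eqxx mulr1n.
by rewrite det_mulmx det_lblock det1 mulr1 dB det_scalar1.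
Qed.

End RankOne.

Section Designs.
Import Order.TTheory GRing.Theory Num.Theory.
Local Open Scope ring_scope.

Lemma ord_enumeration (T : finType) n : #|T| = n -> exists e : 'I_n -> T, bijective e.
Proof. by move=> <-; exists enum_val; exact: enum_val_bij. Qed.

Lemma sum_indicator (R : pzSemiRingType) (T : finType) n (e : 'I_n -> T) (P : pred T) :
  bijective e -> \sum_i (P (e i))%:R = #|[set x | P x]|%:R :> R.
Proof.
move=> be; rewrite -sum1_card natr_sum [RHS]big_mkcond /= (reindex e (onW_bij _ be)).
by apply: eq_bigr => i _; rewrite inE; case: (P _).
Qed.

Variables (v k l : nat) (D : symdesign v k l) (hD : nontrivial_params v k).
Variables (pt : 'I_v -> point D) (bl : 'I_v -> block D).
Hypotheses (pt_bij : bijective pt) (bl_bij : bijective bl).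

Definition incidence_mx : 'M[int]_v := \matrix_(i, j) (inc (pt i) (bl j))%:R.
Local Notation N := incidence_mx.

Lemma incidence_mxMtr : N *m N^T = (k%:R - l%:R)%:M + const_mx l%:R.
Proof.
apply/matrixP=> i j; rewrite !mxE.
transitivity (#|[set b | inc (pt i) b && inc (pt j) b]|%:R : int).
  rewrite -(sum_indicator _ _ bl_bij); apply: eq_bigr => b _.
  by rewrite !mxE -natrM mulnb.
have [<-|neq] := eqVneq i j.
  rewrite mulr1n subrK; congr (_%:R); rewrite -[RHS](point_degree (pt i)).
  by apply: eq_card => b; rewrite !inE andbb.
by rewrite mulr0n add0r pair_degree // (inj_eq (bij_inj pt_bij)).
Qed.

Lemma incidence_mx_row_sum : N *m const_mx 1 = const_mx k%:R :> 'cV_v.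
Proof.
apply/matrixP=> i j; rewrite !mxE -[in RHS](point_degree (pt i)) -(sum_indicator _ _ bl_bij).
by apply: eq_bigr => b _; rewrite !mxE mulr1.
Qed.

Lemma incidence_mx_col_sum : const_mx 1 *m N = const_mx k%:R :> 'rV_v.
Proof.
apply/matrixP=> i j; rewrite !mxE -[in RHS](block_size (bl j)) -(sum_indicator _ _ pt_bij).
by apply: eq_bigr => p _; rewrite !mxE mul1r.
Qed.

Lemma k_gt1 : (1 < k)%N. Proof. by case/andP: hD. Qed.
Lemma v_gt0 : (0 < v)%N. Proof. by move: hD; rewrite /nontrivial_params; lia. Qed.

Lemma const_mxE_mul (c : int) :
  const_mx c = (const_mx c : 'cV_v) *m (const_mx 1 : 'rV_v).
Proof. by apply/matrixP=> i j; rewrite !mxE big_ord1 !mxE mulr1. Qed.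

(** Apply [N N^T] to the all-one vector: directly it gives [k^2], by the formula above
    [(k - l) + l v]. The identity is arranged to avoid subtraction in the naturals. *)
Lemma design_params : (k * k + l = k + l * v)%N.
Proof.
have := congr1 (fun M : 'M_v => (M *m (const_mx 1 : 'cV_v)) (Ordinal v_gt0) 0) incidence_mxMtr.
rewrite -mulmxA.
have -> : N^T *m (const_mx 1 : 'cV_v) = const_mx k%:R.
  by rewrite -[LHS]trmxK trmx_mul trmxK trmx_const incidence_mx_col_sum trmx_const.
have -> : (const_mx k%:R : 'cV[int]_v) = k%:R *: const_mx 1.
  by apply/matrixP=> i j; rewrite !mxE mulr1.
rewrite -scalemxAr incidence_mx_row_sum mulmxDl mul_scalar_mx !mxE mulr1.
rewrite (eq_bigr (fun=> l%:R)); last by move=> i _; rewrite !mxE mulr1.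
rewrite sumr_const card_ord -mulrnA -natrM => E.
apply/eqP; rewrite -(eqr_nat int) !natrD E; apply/eqP; ring.
Qed.

(** Since [k (k - 1) = l (v - 1)], having [l >= k] would force [k >= v]. *)
Lemma l_lt_k_of_enum : (l < k)%N.
Proof. have := design_params; move: hD; rewrite /nontrivial_params; nia. Qed.

Lemma subkl_neq0 : k%:R - l%:R != 0 :> int.
Proof. by rewrite subr_eq0 eqr_nat neq_ltn l_lt_k_of_enum orbT. Qed.

Lemma det_incidence_mxMtr :
  \det (N *m N^T) = (k ^ 2 * (k - l) ^ (v - 1))%:R.
Proof.
(* The rank one formula carries an extra factor [k - l], and its value [k - l + l v] is [k^2]. *)
apply: (mulIf subkl_neq0).
rewrite incidence_mxMtr const_mxE_mul det_scalar_add_rank1 !mxE.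
rewrite (eq_bigr (fun=> l%:R)); last by move=> i _; rewrite !mxE mul1r.
rewrite sumr_const card_ord -mulrnA -natrB ?(ltnW l_lt_k_of_enum) //.
rewrite -natrX -natrD -!natrM; congr (_%:R).
have -> : (k - l + l * v = k ^ 2)%N by have := design_params; have := l_lt_k_of_enum; nia.
by rewrite -mulnA -expnSr; congr (_ * _ ^ _)%N; have := v_gt0; lia.
Qed.

Lemma det_incidence_mx_neq0 : \det N != 0.
Proof.
have : \det (N *m N^T) != 0.
  rewrite det_incidence_mxMtr pnatr_eq0 muln_eq0 !expn_eq0 subn_eq0.
  by have := l_lt_k_of_enum; have := k_gt1; lia.
by rewrite det_mulmx det_tr mulf_eq0 orbb.
Qed.

(** All row and column sums of [N] are [k], so [N] commutes with [J] and hence with [N N^T]. This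
    gives [N (N^T N) = N ((k - l) I + l J)]; over the integers [N] is cancelled through its adjugate
    and its nonzero determinant. *)
Lemma tr_incidence_mxM : N^T *m N = (k%:R - l%:R)%:M + const_mx l%:R.
Proof.
suff E : N *m (N^T *m N) = N *m ((k%:R - l%:R)%:M + const_mx l%:R).
  have := congr1 (mulmx (\adj N)) E; rewrite !mulmxA mul_adj_mx.
  rewrite -mulmxA !mul_scalar_mx => F.
  apply/matrixP=> i j; move/matrixP/(_ i j): F; rewrite !mxE.
  by move/(mulfI det_incidence_mx_neq0).
rewrite mulmxA incidence_mxMtr mulmxDl mulmxDr mul_scalar_mx mul_mx_scalar.
congr (_ + _).
transitivity (const_mx (l%:R * k%:R) : 'M[int]_v).
  rewrite const_mxE_mul -mulmxA incidence_mx_col_sum.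
  by apply/matrixP=> i j; rewrite !mxE big_ord1 !mxE.
have -> : const_mx l%:R = (const_mx 1 : 'cV[int]_v) *m (const_mx l%:R : 'rV[int]_v).
  by apply/matrixP=> i j; rewrite !mxE big_ord1 !mxE mul1r.
rewrite mulmxA incidence_mx_row_sum.
by apply/matrixP=> i j; rewrite !mxE big_ord1 !mxE mulrC.
Qed.

End Designs.

(** * The dual design *)

Section DualDesign.
Import Order.TTheory GRing.Theory Num.Theory.
Local Open Scope ring_scope.
Variables (v k l : nat) (D : symdesign v k l) (hD : nontrivial_params v k).

Lemma l_lt_k : (l < k)%N.
Proof.
have [pt pt_bij] := ord_enumeration (card_point D).
have [bl bl_bij] := ord_enumeration (card_block D).
exact: (l_lt_k_of_enum hD pt_bij bl_bij).
Qed.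

(** The number of common points is an off-diagonal entry of [N^T N]. *)
Lemma block_pair_degree (b c : block D) :
  b != c -> #|[set p | inc p b && inc p c]| = l.
Proof.
move=> neq.
have [pt pt_bij] := ord_enumeration (card_point D).
have [bl bl_bij] := ord_enumeration (card_block D).
have [lb lbK blK] := bl_bij.
have /matrixP/(_ (lb b) (lb c)) := tr_incidence_mxM hD pt_bij bl_bij.
rewrite !mxE (can_eq blK) (negPf neq) mulr0n add0r => E.
apply/eqP; rewrite -(eqr_nat int) -E -(sum_indicator _ _ pt_bij); apply/eqP.
by apply: eq_bigr => p _; rewrite !mxE !blK -natrM mulnb.
Qed.

Definition dual_design : symdesign v k l :=
  @SymDesign v k l (block D) (point D) (fun b p => inc p b)
    (card_block D) (card_point D) (@point_degree _ _ _ D) (@block_size _ _ _ D)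
    block_pair_degree.
End DualDesign.

(** * Magic maps on incidence graphs *)

Section MagicMaps.
Import Order.TTheory GRing.Theory Num.Theory.
Local Open Scope ring_scope.
Variables (v k l : nat) (U : zmodType).

(** This is [N N^T = (k - l) I + l J] acting on labels in an abelian group: [h q] occurs once for
    each block through [p] and [q]. *)
Lemma design_double_count (D : symdesign v k l) (h : point D -> U) p :
  (l <= k)%N ->
  \sum_(b | inc p b) \sum_(q | inc q b) h q = h p *+ (k - l) + (\sum_q h q) *+ l.
Proof.
move=> lek; rewrite (exchange_big_dep predT) //=.
rewrite (eq_bigr (fun q => h q *+ #|[set b | inc p b && inc q b]|)); last first.
  by move=> q _; rewrite sumr_const; congr (_ *+ _); apply: eq_card => b; rewrite !inE.
rewrite -sumrMnl (bigD1 p) //= [in RHS](bigD1 p) //= addrA -mulrnDr subnK //.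
congr (_ + _).
  congr (_ *+ _); rewrite -[RHS](point_degree p).
  by apply: eq_card => b; rewrite !inE andbb.
apply: eq_bigr => q qp; rewrite -[in RHS](pair_degree (s := D) (p := p) (q := q)) 1?eq_sym //.
Qed.

(** The double sum at any point is [k] times [c], so double counting makes [(k - l) h q] independent
    of [q]. Then multiply the sum over a single block by [k - l]. *)
Lemma block_sums_const (D : symdesign v k l) (hD : nontrivial_params v k)
    (h : point D -> U) c :
  (forall b, \sum_(p | inc p b) h p = c) ->
  forall p, h p *+ (k * (k - l)) = c *+ (k - l).
Proof.
move=> hc p; have lek := ltnW (l_lt_k D hD).
have const q : h q *+ (k - l) = h p *+ (k - l).
  apply: (addIr ((\sum_q h q) *+ l)); rewrite -!design_double_count //.
  under eq_bigr do rewrite hc; under [RHS]eq_bigr do rewrite hc.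
  rewrite !sumr_const; congr (_ *+ _).
  transitivity #|[set b | inc q b]|; first by apply: eq_card => b; rewrite !inE.
  by rewrite point_degree -[LHS](point_degree p); apply: eq_card => b; rewrite !inE.
have /card_gt0P[b _] : (0 < #|block D|)%N by rewrite card_block (v_gt0 hD).
rewrite -(hc b) -sumrMnl (eq_bigr (fun=> h p *+ (k - l))) // sumr_const mulnC mulrnA.
by congr (_ *+ _); rewrite -[LHS](block_size b); apply: eq_card => q; rewrite !inE.
Qed.

Variables (D : symdesign v k l) (hD : nontrivial_params v k).

(** Neighbors of a block are its points, and neighbors of a point are its blocks. The design and its
    dual share the constant [c], so both sides of the bipartition get the same value. *)
Lemma magic_mulrn (f : incidence_graph D -> U) c :
  (forall x, \sum_(u in nbh x) f u = c) ->
  forall x, f x *+ (k * (k - l)) = c *+ (k - l).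
Proof.
move=> fc [p|b].
  apply: (@block_sums_const D hD (fun p => f (inl p))) => b.
  rewrite -(fc (inr b)) big_sumType /= [X in _ = _ + X]big_pred0 ?addr0.
    by apply: eq_bigl => q; rewrite !inE.
  by move=> q; rewrite !inE.
apply: (@block_sums_const (dual_design D hD) hD (fun b => f (inr b))) => p.
rewrite -(fc (inl p)) big_sumType /= [X in _ = X + _]big_pred0 ?add0r.
  by apply: eq_bigl => q; rewrite !inE.
by move=> q; rewrite !inE.
Qed.

Lemma magic_subr_mulrn (f : incidence_graph D -> U) c :
  (forall x, \sum_(u in nbh x) f u = c) ->
  forall x y, (f x - f y) *+ (k * (k - l)) = 0.
Proof. by move=> fc x y; rewrite mulrnBl !(magic_mulrn fc) subrr. Qed.

End MagicMaps.

(** * Generators and relations of finite abelian groups *)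

Section FiniteAbelian.
Import Order.TTheory GRing.Theory Num.Theory.
Local Open Scope ring_scope.
Variable A : finZmodType.

(** In a finite group, closure under addition already yields a subgroup. *)
Lemma gen_zmod_ind (S : {set A}) (Q : A -> Prop) :
  Q 0 -> (forall x y, Q x -> Q y -> Q (x + y)) -> {in S, forall x, Q x} ->
  {in <<S>>%g, forall x, Q x}.
Proof.
move=> Q0 QD QS x Sx.
have gQ : group_set [set a : A | `[< Q a >]].
  apply/group_setP; split; first by rewrite inE; exact/asboolP.
  by move=> a b; rewrite !inE => /asboolP Qa /asboolP Qb; apply/asboolP/QD.
suff /subsetP/(_ x Sx) : <<S>>%g \subset Group gQ by rewrite inE => /asboolP.
by rewrite gen_subG; apply/subsetP => a /QS Qa; rewrite inE; apply/asboolP.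
Qed.

Lemma exponent_dvdP n :
  reflect (forall a : A, a *+ n = 0) (exponent [set: A] %| n)%N.
Proof.
by apply: (iffP exponentP) => [H a|H a _]; [exact: (H a (in_setT _)) | exact: H].
Qed.

(** The product of a row vector over the Z-module [A] with an integer matrix. *)
Definition colmul m n (g : 'I_m -> A) (M : 'M[int]_(m, n)) (j : 'I_n) : A :=
  \sum_i g i *~ M i j.

Lemma colmulM m n p g (M : 'M[int]_(m, n)) (P : 'M[int]_(n, p)) :
  colmul (colmul g M) P =1 colmul g (M *m P).
Proof.
move=> j; rewrite /colmul; under eq_bigr do rewrite mulrz_suml.
rewrite exchange_big; apply: eq_bigr => i _; rewrite mxE mulrz_sumr.
by apply: eq_bigr => a _; rewrite mulrzA.
Qed.

(** The group is the sum of the cyclic groups generated by the [g i], of order dividing [d i]. They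
    are added one at a time, using that [|H + K|] divides [|H| |K|]. *)
Lemma card_dvd_prod n (g : 'I_n -> A) (d : 'I_n -> int) :
  (forall i, g i *~ d i = 0) ->
  (forall a, exists x : 'I_n -> int, a = \sum_i g i *~ x i) ->
  (#|A| %| \prod_i `|d i|)%N.
Proof.
move=> gd gen.
pose H (s : seq 'I_n) := <<[set g i | i in s]>>%G.
have Hdvd s : (#|H s| %| \prod_(i <- s) `|d i|)%N.
  elim: s => [|i s IH].
    rewrite big_nil /= (_ : [set g i | i in [::]] = set0) ?gen0 ?cards1 //.
    by apply/setP=> a; rewrite inE; apply/imsetP=> -[].
  have sub : (H (i :: s) \subset <[g i]> <*> H s)%g.
    rewrite gen_subG; apply/subsetP=> _ /imsetP[j js ->].
    move: js; rewrite inE => /predU1P[->|js].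
      by apply: (subsetP (joing_subl _ _)); exact: cycle_id.
    by apply: (subsetP (joing_subr _ _)); apply: mem_gen; apply: imset_f.
  apply: dvdn_trans (cardSg sub) _; rewrite big_cons.
  have -> : (<[g i]> <*> H s)%G = (<[g i]> * H s)%g :> {set A}.
    by apply: cent_joinEl; apply: sub_abelian_cent2 (subsetT _) (subsetT _);
      exact: FinRing.zmod_abelian.
  apply: (@dvdn_trans (#|<[g i]>%g| * #|H s|)%N).
    by rewrite mul_cardG dvdn_mulr.
  apply: dvdn_mul IH; rewrite -[#|_|]/#[g i]%g order_dvdn FinRing.zmodXgE FinRing.zmod1gE.
  apply/eqP.
  by have := gd i; case: (d i) => m //= /eqP; rewrite oppr_eq0 => /eqP.
have full : [set: A] \subset H (index_enum 'I_n).
  apply/subsetP=> a _; have [x ->] := gen a.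
  apply: (big_ind (fun a => a \in H _)); [exact: group1 | by move=> *; exact: groupM |].
  move=> i _.
  have gi : g i \in H (index_enum 'I_n).
    by apply: mem_gen; apply: imset_f; rewrite mem_index_enum.
  by case: (x i) => m; [exact: groupX | rewrite -[_ *~ _]/((g i ^+ m.+1)^-1)%g groupV groupX].
by rewrite -cardsT; apply: dvdn_trans (cardSg full) (Hdvd _).
Qed.

(* In Smith normal form the relations say that suitable generators have orders
   dividing the diagonal entries. *)
Lemma card_dvd_det n (g : 'I_n -> A) (T : 'M[int]_n) :
  (forall j, \sum_i g i *~ T i j = 0) ->
  (forall a, exists x : 'I_n -> int, a = \sum_i g i *~ x i) ->
  (#|A| %| `|\det T|)%N.
Proof.
move=> gT gen; have [L Lu [R Ru [d _ ET]]] := int_Smith_normal_form T.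
pose S : 'M[int]_n := \matrix_(i, j) (d`_i *+ (i == j :> nat)).
have -> : `|\det T|%N = (\prod_(i < n) `|(d`_i)%R|)%N.
  have unit1 (M : 'M[int]_n) : M \in unitmx -> `|\det M|%N = 1%N.
    rewrite unitmxE => /mulrV/(congr1 absz)/eqP; rewrite abszM muln_eq1.
    by case/andP => /eqP.
  rewrite ET !det_mulmx !abszM (unit1 L) // (unit1 R) // mul1n muln1 det_trig.
    rewrite (big_morph absz abszM (erefl : `|1%Z|%N = 1%N)).
    by apply: eq_bigr => i _; rewrite mxE eqxx mulr1n.
  by apply/is_trig_mxP => i j ij; rewrite mxE ltn_eqF.
apply: (@card_dvd_prod n (colmul g L)).
  move=> j; have -> : colmul g L j *~ d`_j = colmul (colmul g L) S j.
    rewrite [RHS](bigD1 j) //= big1 => [|i ij]; rewrite mxE.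
      by rewrite eqxx mulr1n addr0.
    by rewrite (inj_eq val_inj) (negPf ij) mulr0z.
  (* Here [L S = T R^-1], and [g T = 0]. *)
  rewrite colmulM -[L *m S](mulmxK Ru) -ET -colmulM /colmul big1 // => i _.
  by rewrite [X in X *~ _]gT mul0rz.
move=> a; have [x ->] := gen a.
exists (fun i => (invmx L *m \col_i x i) i 0).
have <- : colmul g (\col_i x i) 0 = \sum_i g i *~ x i.
  by apply: eq_bigr => i _; rewrite mxE.
by rewrite -[LHS]/(colmul _ _ _) -[X in colmul g X](mulKVmx Lu) -colmulM.
Qed.

End FiniteAbelian.

(** * Invariant factors *)

Section Coordinates.
Import Order.TTheory GRing.Theory Num.Theory.
Local Open Scope ring_scope.

Lemma invariant_factors_gt0 (A : finZmodType) d :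
  invariant_factors A d -> forall i, (i < size d)%N -> (0 < nth 0%N d i)%N.
Proof.
case=> [[/andP[_ /allP dgt1]|[_ ->]] _ _] i; last by case: i.
by move=> /(mem_nth 0%N)/dgt1/ltnW.
Qed.

Lemma invariant_factors_size_gt0 (A : finZmodType) d :
  invariant_factors A d -> (0 < size d)%N.
Proof. by case=> [[/andP[]|[_ ->]]] //; case: d. Qed.

Lemma invariant_factors_dvdn (A : finZmodType) d :
  invariant_factors A d -> forall i j, (i <= j < size d)%N -> (nth 0%N d i %| nth 0%N d j)%N.
Proof.
case=> _ sd _ i j /andP[ij js].
exact: (sorted_leq_nth dvdn_trans dvdnn 0%N sd) (leq_ltn_trans ij js) js ij.
Qed.

(** Natural representatives of the coordinates under the isomorphism; congruences express
    additivity, injectivity and surjectivity, and hide the dependent type of [cyclic_sum]. *)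
Lemma invariant_coordinates (A : finZmodType) d : invariant_factors A d ->
  exists c : A -> 'I_(size d) -> nat,
  [/\ forall a b i, c (a + b) i = (c a i + c b i)%N %[mod nth 0%N d i],
      forall a, (forall i : 'I_(size d), nth 0%N d i %| c a i)%N -> a = 0
    & forall x : 'I_(size d) -> nat, exists a, forall i, c a i = x i %[mod nth 0%N d i] ].
Proof.
move=> hd; case: (hd) => _ _ /isogP[phi /injmP phi_inj phi_im].
have dE (i : 'I_(size d)) : (nth 0%N d i).-1.+1 = nth 0%N d i.
  by rewrite prednK // (invariant_factors_gt0 hd).
have modE (i : 'I_(size d)) m : (m %% (nth 0%N d i).-1.+1)%N = (m %% nth 0%N d i)%N.
  by rewrite dE.
exists (fun a i => val ((phi a : {dffun forall i : 'I_(size d), 'I_(nth 0%N d i).-1.+1}) i)).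
split=> [a b i|a ca|x].
- by rewrite -[a + b]/(a * b)%g morphM ?inE // ffunE /= modE modn_mod.
- apply: (phi_inj a 1%g); rewrite ?inE // morph1.
  apply/ffunP=> i; rewrite [in RHS]ffunE; apply/val_inj => /=.
  by have := ca i; rewrite /dvdn -modE (modn_small (ltn_ord _)) => /eqP.
pose y : cyclic_sum d := [ffun i => inord (x i %% nth 0%N d i)].
have : y \in (phi @* [set: A])%g by rewrite phi_im inE.
case/morphimP=> a _ _ ya; exists a => i.
rewrite -ya ffunE /= inordK ?modn_mod // dE ltn_mod.
exact: (invariant_factors_gt0 hd).
Qed.

Lemma coordinate_mulrn (A : finZmodType) n m (c : A -> nat) :
  (forall a b, c (a + b) = (c a + c b)%N %[mod m]) ->
  forall a, c (a *+ n) = (n * c a)%N %[mod m].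
Proof.
move=> cD a; elim: n => [|n IH]; last first.
  by rewrite mulrS cD mulSn -modnDmr IH modnDmr.
(* Additivity at [0 + 0] gives [c 0 = 0] modulo [m]. *)
apply/eqP; have /eqP := cD 0 0; rewrite addr0 -{1}[c 0]addn0 eqn_modDl.
by rewrite mulr0n mul0n eq_sym.
Qed.

(** An element with all coordinates 1 shows that [d_r] divides the exponent; conversely every [d_i]
    divides [d_r], so [d_r] kills each coordinate. *)
Lemma invariant_factors_exponent (A : finZmodType) d :
  invariant_factors A d -> nth 0%N d (size d - 1) = exponent [set: A].
Proof.
move=> hd; have [c [cD c0 cS]] := invariant_coordinates hd.
have s0 := invariant_factors_size_gt0 hd.
apply/eqP; rewrite eqn_dvd; apply/andP; split.
  have lt : (size d - 1 < size d)%N by lia.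
  have [a ca] := cS (fun=> 1%N); pose i := Ordinal lt.
  have E := coordinate_mulrn (exponent [set: A]) (fun a b => cD a b i) a.
  have a0 : a *+ exponent [set: A] = 0 by exact: (elimT (exponent_dvdP _ _)) (dvdnn _) _.
  have E0 := coordinate_mulrn 0 (fun a b => cD a b i) a.
  rewrite mulr0n mul0n -a0 E -modnMmr ca modnMmr muln1 in E0.
  by rewrite /dvdn [X in X == _]E0 mod0n.
apply/exponent_dvdP => a; apply: c0 => i; rewrite /dvdn.
rewrite (coordinate_mulrn _ (fun a b => cD a b i)) -/(dvdn _ _); apply: dvdn_mulr.
by apply: (invariant_factors_dvdn hd); have := ltn_ord i; lia.
Qed.

(* If [n A = <n x>], compare the coordinates of [n e_(r-1)] and [n e_r] with
   those of [n x]. *)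
Lemma invariant_factors_mul_cyclic (A : finZmodType) d n (x : A) :
  invariant_factors A d -> (2 <= size d)%N ->
  (forall a, exists m, a *+ n = x *+ n *+ m) -> (nth 0%N d (size d - 2) %| n)%N.
Proof.
move=> hd s2 cyc; have [c [cD _ cS]] := invariant_coordinates hd.
have lt1 : (size d - 2 < size d)%N by lia.
have lt2 : (size d - 1 < size d)%N by lia.
pose i := Ordinal lt1; pose j := Ordinal lt2; set q := nth _ _ _.
have qj : (q %| nth 0%N d j)%N by apply: (invariant_factors_dvdn hd) => /=; lia.
have cM h a m : c (a *+ m) h = (m * c a h)%N %[mod nth 0%N d h].
  exact: coordinate_mulrn (fun a b => cD a b h) a.
have cMj a m : c (a *+ m) j = (m * c a j)%N %[mod q].
  by rewrite -(modn_dvdm _ qj) cM modn_dvdm.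
have [e1 ce1] := cS (fun h => (h == i)%N); have [e2 ce2] := cS (fun h => (h == j)%N).
have ij : i != j by rewrite -val_eqE /=; lia.
have [m1 E1] := cyc e1; have [m2 E2] := cyc e2.
have ce2j : c e2 j = 1%N %[mod q] by rewrite -(modn_dvdm _ qj) ce2 eqxx modn_dvdm.
have ce1j : c e1 j = 0%N %[mod q].
  by rewrite -(modn_dvdm _ qj) ce1 eq_sym (negPf ij) modn_dvdm.
have ce1i : c e1 i = 1%N %[mod q] by rewrite ce1 eqxx.
have ce2i : c e2 i = 0%N %[mod q] by rewrite ce2 (negPf ij).
(* Modulo [q]: [n = m1 n x_i], [0 = m1 n x_j] and [n = m2 n x_j]. *)
have F1 : n = (m1 * (n * c x i))%N %[mod q].
  by rewrite -modnMmr -cM modnMmr -cM -E1 cM -modnMmr ce1i modnMmr muln1.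
have F2 : 0%N = (m1 * (n * c x j))%N %[mod q].
  by rewrite -modnMmr -cMj modnMmr -cMj -E1 cMj -modnMmr ce1j modnMmr muln0.
have F3 : n = (m2 * (n * c x j))%N %[mod q].
  by rewrite -modnMmr -cMj modnMmr -cMj -E2 cMj -modnMmr ce2j modnMmr muln1.
(* In [n = m1 n x_i] replace [n] on the right by [m2 n x_j]; the factor [m1 n x_j = 0] appears. *)
rewrite /dvdn F1 mulnCA -modnMml F3 modnMml.
have -> : (m2 * (n * c x j) * (m1 * c x i) = m1 * (n * c x j) * (m2 * c x i))%N by ring.
by rewrite -modnMml -F2 modnMml mul0n mod0n.
Qed.

(* [B a b = sum_i (e / d_i) a_i b_i] modulo [e = d_r]. *)
Lemma invariant_factors_pairing (A : finZmodType) d : invariant_factors A d ->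
  exists e : int, exists B : A -> A -> int, [/\ e != 0,
    forall a a' b, (e %| B (a + a') b - (B a b + B a' b))%Z,
    forall a b b', (e %| B a (b + b') - (B a b + B a b'))%Z
  & forall a, (forall b, (e %| B a b)%Z) -> a = 0].
Proof.
move=> hd; have [c [cD c0 cS]] := invariant_coordinates hd.
have s0 := invariant_factors_size_gt0 hd.
set e := nth 0%N d (size d - 1).
have de (i : 'I_(size d)) : (nth 0%N d i %| e)%N.
  by apply: (invariant_factors_dvdn hd); have := ltn_ord i; lia.
have e0 : (0 < e)%N by apply: (invariant_factors_gt0 hd); lia.
(* The weight [e / d_i] turns divisibility by [d_i] into divisibility by [e], so the choice of
   representatives is harmless. *)
have step (i : 'I_(size d)) (x y : int) : (Posz (nth 0%N d i) %| x)%Z ->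
    (e%:Z %| (e %/ nth 0%N d i)%:Z * x * y)%Z.
  case/dvdzP=> z ->; apply/dvdzP; exists (z * y).
  rewrite -{2}(divnK (de i)) PoszM; ring.
have cDz a b (i : 'I_(size d)) :
    (Posz (nth 0%N d i) %| (c (a + b) i)%:Z - ((c a i)%:Z + (c b i)%:Z))%Z.
  by rewrite -PoszD -eqz_mod_dvd !modz_nat cD.
exists e%:Z, (fun a b => \sum_(i < size d) (e %/ nth 0%N d i)%:Z * (c a i)%:Z * (c b i)%:Z).
split=> [|a a' b|a b b'|a H].
- by rewrite eqz_nat -lt0n.
- rewrite -big_split -sumrB /=; apply: rpred_sum => i _.
  by rewrite -mulrDl -mulrBl -mulrDr -mulrBr; apply: step.
- rewrite -big_split -sumrB /=; apply: rpred_sum => i _.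
  by rewrite -mulrDr -mulrBr -mulrA [X in _ * X]mulrC mulrA; apply: step.
(* Pairing with the [i]-th basis vector leaves [(e / d_i) a_i] modulo [e], whence [d_i] divides
   [a_i]. *)
apply: c0 => i; have [b cb] := cS (fun h => (h == i)%N).
have := H b; rewrite (bigD1 i) //= rpredDr; last first.
  apply: rpred_sum => h hi; rewrite -mulrA [X in _ * X]mulrC mulrA; apply: step.
  by rewrite dvdzE /= /dvdn cb (negPf hi) mod0n.
move=> H1.
have H2 : (e %| (e %/ nth 0%N d i)%:Z * (c a i)%:Z * ((c b i)%:Z - 1%:Z))%Z.
  rewrite -mulrA [X in _ * X]mulrC mulrA; apply: step.
  by rewrite -eqz_mod_dvd !modz_nat cb eqxx.
have := rpredB H1 H2; rewrite -mulrBr subKr mulr1 -PoszM dvdzE /=.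
rewrite -{1}(divnK (de i)) dvdn_pmul2l; first by [].
rewrite divn_gt0; first exact: dvdn_leq e0 (de i).
exact: (invariant_factors_gt0 hd).
Qed.

End Coordinates.

(** * The embedding into the reduced group *)

Section Embedding.
Import Order.TTheory GRing.Theory Num.Theory.
Local Open Scope ring_scope.
Local Open Scope quotient_scope.

(** Collapses the two nested quotients: [S_red G] is the integer lattice on the vertices modulo the
    image of the adjacency operator and the all-one vector. *)
Lemma S_red_eqP (G : Defs.rgraph) (x y : {ffun G -> int}) :
  \pi_(S_red G) (\pi_(Lambda1 G) x) = \pi_(S_red G) (\pi_(Lambda1 G) y) <->
  exists z : {ffun G -> int}, exists s : int, x - y = adj_op z + [ffun=> 1] *~ s.
Proof.
have piE (p q : Lambda1 G) :
    \pi_(S_red G) p = \pi_(S_red G) q <-> p - q \in @im_pred _ _ (@Abar G).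
  by rewrite Quotient.idealrBE; split=> [->|/eqP].
have piE1 (p q : {ffun G -> int}) :
    \pi_(Lambda1 G) p = \pi_(Lambda1 G) q <-> p - q \in @ones_pred G.
  by rewrite Quotient.idealrBE; split=> [->|/eqP].
rewrite piE -raddfB /=; split=> [/asboolP[q]|[z [s E]]].
  rewrite -[q]reprK /= Abar_funE => /piE1/asboolP[s E].
  by exists (generic_quotient.repr q), s; rewrite -E [RHS]addrC subrK.
apply/asboolP; exists (\pi_(Lambda1 G) z); rewrite /= Abar_funE; apply/piE1.
by apply/asboolP; exists s; rewrite E addrAC subrr add0r.
Qed.

Lemma adj_opE (G : Defs.rgraph) (x : {ffun G -> int}) u :
  adj_op x u = \sum_(w in nbh u) x w.
Proof.
rewrite ffunE [RHS]big_mkcond; apply: eq_bigr => w _.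
by rewrite /adj_entry inE; case: (adj u w); rewrite ?mul1r ?mul0r.
Qed.

(* Lift [<a, f _>] to an integer vector [beta]. The magic property makes
   [A beta] constant modulo [e], i.e. [A beta = t 1 + e y], and [a] is sent to the
   class of [y]. *)
Lemma embeds_S_red (G : Defs.rgraph) (A : finZmodType) d (f : G -> A) :
  (forall (g : G -> int) c, (forall x, \sum_(u in nbh x) g u = c) ->
    forall u w, g u = g w) ->
  invariant_factors A d -> magic_map f -> affinely_generating f ->
  embeds A (S_red G).
Proof.
move=> int_magic hd [gamma fg] gen.
have [e [B [e0 Bl Br Bnd]]] := invariant_factors_pairing hd.
have onesE (s : int) (u : G) : ([ffun=> 1 : int] *~ s) u = s.
  by rewrite ffunMzE ffunE intz.
have Br0 a : (e %| B a 0%R)%Z.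
  by have := Br a 0 0; rewrite addr0 opprD addrA subrr add0r rpredN.
have Bsum a (P : {pred G}) : (e %| B a (\sum_(w in P) f w) - \sum_(w in P) B a (f w))%Z.
  apply: (big_rec2 (fun b s => e %| B a b - s)%Z) => [|w b s _ E]; first by rewrite subr0.
  have -> : B a (f w + b) - (B a (f w) + s) =
     (B a (f w + b) - (B a (f w) + B a b)) + (B a b - s) by ring.
  exact: rpredD.
pose beta a : {ffun G -> int} := [ffun w => B a (f w)].
(* The constant is [t = B a gamma]; the magic property makes the division exact. *)
pose y a : {ffun G -> int} := [ffun u => ((adj_op (beta a) u - B a gamma) %/ e)%Z].
have yE a u : adj_op (beta a) u = B a gamma + e * y a u.
  rewrite [y a u]ffunE [e * _]mulrC divzK; first by rewrite addrC subrK.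
  rewrite adj_opE -(fg u) -opprB rpredN.
  by rewrite (eq_bigr (fun w => B a (f w))) // => w _; rewrite ffunE.
pose h a : S_red G := \pi_(S_red G) (\pi_(Lambda1 G) (y a)).
have hD a b : h (a + b) = h a + h b.
  rewrite /h -!raddfD /=; apply/S_red_eqP.
  (* [z] and [s] are the carries, divided by [e], of the lifts of the labels and of [gamma]; [y] is
     additive up to [adj_op z] minus [s] times the all-one vector. *)
  pose z : {ffun G -> int} :=
    [ffun w => ((B (a + b) (f w) - (B a (f w) + B b (f w))) %/ e)%Z].
  pose s : int := ((B (a + b) gamma - (B a gamma + B b gamma)) %/ e)%Z.
  have es : e * s = B (a + b) gamma - (B a gamma + B b gamma) by rewrite mulrC divzK.
  exists z, (- s); apply/ffunP=> u; apply: (mulfI e0).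
  have ez : e * adj_op z u =
      adj_op (beta (a + b)) u - (adj_op (beta a) u + adj_op (beta b) u).
    rewrite !adj_opE mulr_sumr -big_split -sumrB; apply: eq_bigr => w _.
    by rewrite [z w]ffunE mulrC divzK // !ffunE.
  transitivity (e * (y (a + b) u - (y a u + y b u))); first by rewrite !ffunE.
  transitivity (e * (adj_op z u - s)).
    by rewrite !mulrBr mulrDr ez es !yE; ring.
  by rewrite [in RHS]ffunE onesE.
have hB : zmod_morphism h by move=> a b; apply: (addIr (h b)); rewrite -hD !subrK.
pose hA : {additive A -> S_red G} :=
  HB.pack h (GRing.isZmodMorphism.Build A (S_red G) h hB).
exists hA; apply: raddf_inj => a ha0.
have {ha0} /S_red_eqP[x [s E]] :
    \pi_(S_red G) (\pi_(Lambda1 G) (y a)) = \pi_(S_red G) (\pi_(Lambda1 G) 0).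
  by rewrite [LHS]ha0 -(subrr (0 : {ffun G -> int})) !raddfB /= !subrr.
rewrite subr0 in E.
(* If [y a = adj_op x + s 1], then [beta a - e x] is an integer magic map, hence constant, so
   [beta a] is constant modulo [e]. *)
have dvd u w : (e %| B a (f u) - B a (f w))%Z.
  pose g v := B a (f v) - e * x v.
  have gc : forall u', \sum_(v in nbh u') g v = B a gamma + e * s.
    move=> u'; rewrite sumrB -mulr_sumr -adj_opE.
    have -> : \sum_(v in nbh u') B a (f v) = adj_op (beta a) u'.
      by rewrite adj_opE; apply: eq_bigr => v _; rewrite ffunE.
    have Eu : y a u' = adj_op x u' + s by rewrite E [LHS]ffunE onesE.
    by rewrite yE Eu; ring.
  have := int_magic g _ gc u w; rewrite /g => E'.
  apply/dvdzP; exists (x u - x w).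
  have -> : B a (f u) = B a (f u) - e * x u + e * x u by ring.
  by rewrite E'; ring.
(* Thus [a] pairs to zero with all label differences, which generate [A]; nondegeneracy gives
   [a = 0]. *)
apply: Bnd => b; have : b \in [set: A] by rewrite inE.
rewrite -gen; move: b; apply: gen_zmod_ind => // [b b' Hb Hb'|_ /imset2P[u w _ _ ->]].
  rewrite -(subrK (B a b + B a b') (B a (b + b'))); apply: rpredD; first exact: Br.
  exact: rpredD.
have := Br a (f u - f w) (f w); rewrite subrK => Bs.
have -> : B a (f u - f w) = (B a (f u) - B a (f w)) -
    (B a (f u) - (B a (f u - f w) + B a (f w))) by ring.
exact: rpredB.
Qed.
End Embedding.

(** * The order of a distance magic group *)

Section Order.
Import Order.TTheory GRing.Theory Num.Theory.
Local Open Scope ring_scope.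

(** As [1^T M = k 1^T], one has [k (M - w 1^T) = (k I - w 1^T) M], and the rank one formula
    evaluates the first factor with [k - (k - 1) = 1]. *)
Lemma det_sub_rank1 (R : idomainType) n (M : 'M[R]_n) (k : R) (w : 'cV[R]_n) :
  k != 0 -> const_mx 1 *m M = k *: const_mx 1 :> 'rV_n ->
  \sum_i w i 0 = k - 1 -> \det (M - w *m const_mx 1) * k = \det M.
Proof.
move=> k0 Mk wk; have kn : k ^+ n != 0 by rewrite expf_neq0.
have E : k *: (M - w *m const_mx 1) = (k%:M + (- w) *m const_mx 1) *m M.
  rewrite mulmxDl -mulmxA Mk mul_scalar_mx mulNmx -scalemxAr.
  by rewrite scalerBr.
apply: (mulfI kn); rewrite mulrA -detZ E det_mulmx mulrAC det_scalar_add_rank1.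
rewrite [(const_mx 1 *m - w) 0 0]mxE (_ : \sum_j _ = - (k - 1)).
  by rewrite opprB addrC subrK mul1r.
by rewrite -wk -sumrN; apply: eq_bigr => i _; rewrite !mxE mul1r.
Qed.

Variables (v k l : nat) (D : symdesign v k l) (hD : nontrivial_params v k).
Variables (pt : 'I_v -> point D) (bl : 'I_v -> block D).
Hypotheses (pt_bij : bijective pt) (bl_bij : bijective bl).
Local Notation N := (incidence_mx pt bl).
Local Notation M := (block_mx 0 N N^T 0 : 'M_(v + v)).

Definition vertex_enum (i : 'I_(v + v)) : incidence_graph D :=
  match split i with inl p => inl (pt p) | inr b => inr (bl b) end.

Lemma vertex_enum_bij : bijective vertex_enum.
Proof.
case: pt_bij bl_bij => tp tpK ptK [lb lbK blK].
exists (fun x : point D + block D =>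
          match x with inl p => lshift v (tp p) | inr b => rshift v (lb b) end).
  by move=> i; rewrite /vertex_enum; case: (splitP i) => j ij; apply/val_inj; rewrite /= ?tpK ?lbK.
by case=> x; rewrite /vertex_enum ?(unsplitK (inl _)) ?(unsplitK (inr _)) ?ptK ?blK.
Qed.

Lemma incidence_graph_mxE i j : M i j = (adj (vertex_enum i) (vertex_enum j))%:R.
Proof.
by rewrite /vertex_enum !mxE; case: (split i) => a; rewrite !mxE;
   case: (split j) => b; rewrite !mxE.
Qed.

Lemma incidence_graph_mx_col_sum : const_mx 1 *m M = k%:R *: const_mx 1 :> 'rV_(v + v).
Proof.
have cN : const_mx 1 *m N^T = const_mx k%:R :> 'rV_v.
  by rewrite -[LHS]trmxK trmx_mul trmxK trmx_const incidence_mx_row_sum // trmx_const.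
rewrite -row_mx_const mul_row_block !mulmx0 add0r addr0 cN incidence_mx_col_sum //.
by rewrite !row_mx_const; apply/matrixP=> i j; rewrite !mxE mulr1.
Qed.

(** [M^2] is block diagonal with blocks [N N^T] and [N^T N], which determines [det M] up to sign. *)
Lemma det_incidence_graph_mx : `|\det M|%N = (k ^ 2 * (k - l) ^ (v - 1))%N.
Proof.
have E : \det M ^+ 2 = (\det (N *m N^T)) ^+ 2.
  rewrite expr2 -det_mulmx mulmx_block !mulmx0 !mul0mx !add0r !addr0.
  by rewrite det_ublock !det_mulmx det_tr; ring.
have /eqP := congr1 absz E; rewrite !abszX eqn_exp2r // => /eqP ->.
by rewrite (det_incidence_mxMtr hD pt_bij bl_bij) natz.
Qed.
End Order.

(** * Divisibility and cyclicity for generating maps, and the distance magic case *)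

Section Main.
Import Order.TTheory GRing.Theory Num.Theory.
Local Open Scope ring_scope.

(* If [f x0 = 0] and [f x1 = gamma], the columns of [M - (e_x1 + (k - 2) e_x0) 1^T]
   are relations among the labels, and this matrix has determinant [det M / k]. *)
Lemma distance_magic_card_dvdn v k l (D : symdesign v k l) (A : finZmodType)
    (f : incidence_graph D -> A) :
  nontrivial_params v k -> distance_magic_labeling f ->
  (#|A| %| k * (k - l) ^ (v - 1))%N.
Proof.
move=> hD [f_bij [gamma fg]].
have [pt pt_bij] := ord_enumeration (card_point D).
have [bl bl_bij] := ord_enumeration (card_block D).
have [inv eK Ke] := vertex_enum_bij pt_bij bl_bij.
have [fi fK Kf] := f_bij.
pose e := vertex_enum pt bl; pose x0 := inv (fi 0); pose x1 := inv (fi gamma).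
have fx0 : f (e x0) = 0 by rewrite /e Ke Kf.
have fx1 : f (e x1) = gamma by rewrite /e Ke Kf.
set M := block_mx 0 (incidence_mx pt bl) (incidence_mx pt bl)^T 0 : 'M_(v + v).
(* The entries sum to [k - 1], as the determinant formula requires, while the labels weighted by [w]
   sum to [gamma], since [k - 2] falls on the label 0. The case [gamma = 0], with [x0 = x1], is
   covered. *)
pose w : 'cV[int]_(v + v) := \col_i ((i == x1)%:R + (k - 2)%:R * (i == x0)%:R).
have k1 := k_gt1 hD.
have sum_delta (U : zmodType) (F : 'I_(v + v) -> U) x :
    \sum_i F i *~ (i == x)%:R = F x.
  rewrite (bigD1 x) //= eqxx mulr1z big1 ?addr0 // => i /negPf->.
  by rewrite mulr0z.
have intE (a b : int) : a *~ b = a * b by rewrite -mulrzr intz.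
have detE : `|(\det (M - w *m const_mx 1))%R|%N = (k * (k - l) ^ (v - 1))%N.
  have k0 : (k%:R : int) != 0 by rewrite pnatr_eq0; lia.
  have wk : \sum_i w i 0 = k%:R - 1.
    transitivity (\sum_i (1 : int) *~ (i == x1)%:R + \sum_i (k - 2)%:R *~ (i == x0)%:R).
      by rewrite -big_split; apply: eq_bigr => i _; rewrite mxE !intE mul1r.
    by rewrite !sum_delta natrB //; ring.
  have := det_sub_rank1 k0 (incidence_graph_mx_col_sum pt_bij bl_bij) wk.
  move/(congr1 absz); rewrite abszM (det_incidence_graph_mx hD pt_bij bl_bij) natz /=.
  move/eqP; rewrite mulnC -mulnA eqn_pmul2l; last by lia.
  by move/eqP.
rewrite -detE; apply: (@card_dvd_det _ _ (f \o e)) => [j|a]; last first.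
  (* Every element of [A] is itself a label. *)
  exists (fun i => (i == inv (fi a))%:R).
  by rewrite (sum_delta _ (f \o e)) /= /e Ke Kf.
have Mj : \sum_i f (e i) *~ M i j = gamma.
  rewrite -(fg (e j)) (reindex e (onW_bij _ (vertex_enum_bij pt_bij bl_bij))) [RHS]big_mkcond.
  apply: eq_bigr => i _; rewrite incidence_graph_mxE inE adj_sym.
  by case: (adj _ _).
have wj : \sum_i f (e i) *~ w i 0 = gamma.
  transitivity (\sum_i f (e i) *~ (i == x1)%:R + \sum_i f (e i) *~ (k - 2)%:R *~ (i == x0)%:R).
    by rewrite -big_split; apply: eq_bigr => i _; rewrite mxE mulrzDr mulrzA.
  by rewrite !sum_delta fx0 fx1 mul0rz addr0.
transitivity (\sum_i f (e i) *~ M i j - \sum_i f (e i) *~ w i 0).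
  rewrite -sumrB; apply: eq_bigr => i _ /=.
  rewrite -mulrzBr [in LHS]mxE [X in _ + X]mxE [(w *m _) i j]mxE big_ord1.
  by rewrite [const_mx _ _ _]mxE mulr1.
by rewrite Mj wj subrr.
Qed.

(** Since 0 is a label, each element is a difference of labels. *)
Lemma bijective_affinely_generating (G : Defs.sgraph) (A : finZmodType) (f : G -> A) :
  bijective f -> affinely_generating f.
Proof.
case=> fi fK Kf; apply/setP=> a; rewrite !inE; apply: mem_gen.
by apply/imset2P; exists (fi a) (fi 0); rewrite ?inE // !Kf subr0.
Qed.

Lemma affinely_generating_exponent_dvdn v k l (D : symdesign v k l) (A : finZmodType)
    (f : incidence_graph D -> A) :
  nontrivial_params v k -> magic_map f -> affinely_generating f ->
  (exponent [set: A] %| k * (k - l))%N.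
Proof.
move=> hD [c fc] gen; apply/exponent_dvdP => a.
have : a \in [set: A] by rewrite inE.
rewrite -gen; move: a; apply: gen_zmod_ind => [|a b Ha Hb|_ /imset2P[x y _ _ ->]].
- by rewrite mul0rn.
- by rewrite mulrnDl Ha Hb addr0.
exact: (magic_subr_mulrn hD fc).
Qed.

(** All labels have the same multiple by [k (k - l)], so that of any one label generates
    [k (k - l) A]. *)
Lemma generating_mul_cyclic v k l (D : symdesign v k l) (A : finZmodType)
    (f : incidence_graph D -> A) :
  nontrivial_params v k -> magic_map f -> generating f ->
  exists x : A, forall a, exists m, a *+ (k * (k - l)) = x *+ (k * (k - l)) *+ m.
Proof.
move=> hD [c fc] gen.
have /card_gt0P[p _] : (0 < #|point D|)%N by rewrite card_point (v_gt0 hD).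
exists (f (inl p)) => a; have : a \in [set: A] by rewrite inE.
rewrite -gen; move: a; apply: gen_zmod_ind => [|a b [m Ha] [n Hb]|_ /imsetP[x _ ->]].
- by exists 0%N; rewrite mul0rn mulr0n.
- by exists (m + n)%N; rewrite mulrnDl Ha Hb mulrnDr.
by exists 1%N; apply/eqP; rewrite mulr1n -subr_eq0 -mulrnBl (magic_subr_mulrn hD fc).
Qed.

(** The integers are torsion-free and [k (k - l)] is positive; this supplies the injectivity of the
    embedding. *)
Lemma magic_int_const v k l (D : symdesign v k l) (g : incidence_graph D -> int) c :
  nontrivial_params v k -> (forall x, \sum_(u in nbh x) g u = c) ->
  forall u w, g u = g w.
Proof.
move=> hD gc u w; apply/eqP; rewrite -subr_eq0.
have /eqP := magic_subr_mulrn hD gc u w.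
rewrite mulrn_eq0 muln_eq0 subn_eq0 leqNgt (l_lt_k D hD) orbF.
by have := k_gt1 hD; case: (k).
Qed.

End Main.

Theorem theorem5p13 (v k l : nat) (D : symdesign v k l)
    (hD : nontrivial_params v k)
    (A : finZmodType) (d : seq nat) (hd : invariant_factors A d) :
  let G := incidence_graph D in
  let r := size d in
  [/\ (exists2 f : G -> A, magic_map f & affinely_generating f) ->
        nth 0 d (r - 1) = exponent [set: A] /\ exponent [set: A] %| k * (k - l),
      2 <= r ->
        (exists2 f : G -> A, magic_map f & generating f) ->
        nth 0 d (r - 2) %| k * (k - l)
    & #|A| = 2 * v ->
        (exists f : G -> A, distance_magic_labeling f) ->
        embeds A (S_red G) /\ 2 * v %| k * (k - l) ^ (v - 1)].
Proof.
split=> [[f fm fg]|r2 [f fm fg]|cA [f fd]].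
- split; first exact: invariant_factors_exponent.
  exact: affinely_generating_exponent_dvdn fm fg.
- have [x cyc] := generating_mul_cyclic hD fm fg.
  exact: invariant_factors_mul_cyclic hd r2 cyc.
split; last by rewrite -cA (distance_magic_card_dvdn hD fd).
have [f_bij fm] := fd.
apply: embeds_S_red hd fm (bijective_affinely_generating f_bij).
by move=> g c; exact: magic_int_const.
Qed.
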